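(* Let $\lambda,\lambda_1,\beta>0$. Let $N_1$ be a Poisson process with intensity $\lambda_1$ and let $E_N$ be a compound Poisson process with intensity $\lambda$ and exponentially distributed jumps with rate $\beta$, independent of $N_1$. Put $X(t)=N_1(E_N(t))$ and $p_k^E(t)=P(X(t)=k)$, $t\ge 0$. Then for $k\ge 1$ $$p_k^{E}(t)=e^{-\lambda t}\,\frac{\lambda_1^{k}\lambda\beta t}{(\lambda_1+\beta)^{k+1}}\,\mathcal{E}_{1,2}^{k+1}\left(\frac{\lambda\beta t}{\lambda_1+\beta}\right),$$ and $$p_0^E(t)=\exp\left\{-\frac{\lambda\lambda_1 t}{\lambda_1+\beta}\right\}.$$ Moreover, the probabilities $p_k^E(t)$, $k\ge 0$, satisfy $$\frac{d}{dt}p_k^{E}(t)=-\lambda\frac{\lambda_1}{\lambda_1+\beta}\,p_k^{E}(t)+\frac{\lambda\beta}{\lambda_1+\beta}\sum_{m=1}^{k}\left(\frac{\lambda_1}{\lambda_1+\beta}\right)^{m}p_{k-m}^{E}(t),$$ where the sum is empty (equal to $0$) for $k=0$.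
   Context: $E_N(t)=\sum_{j=1}^{N(t)}\xi_j$, where $N$ is a Poisson process with intensity $\lambda$ and $\xi_j$ are i.i.d. exponential random variables with rate $\beta$ (density $\beta e^{-\beta x}$, $x>0$), independent of $N$ (empty sum $=0$). The three-parameter generalized Mittag-Leffler function is $\mathcal{E}_{\rho,\delta}^{\gamma}(z)=\sum_{j=0}^{\infty}\frac{\Gamma(\gamma+j)}{\Gamma(\gamma)}\frac{z^{j}}{j!\,\Gamma(\rho j+\delta)}$. *)

(* Defs.v *)
From HB Require Import structures.
From mathcomp Require Import all_boot all_order all_algebra finmap.
From mathcomp Require Import all_classical all_reals all_analysis.
Set Implicit Arguments.
Unset Strict Implicit.
Unset Printing Implicit Defensive.
Import Order.TTheory GRing.Theory Num.Theory.
Import numFieldNormedType.Exports.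
Local Open Scope classical_set_scope.
Local Open Scope ring_scope.

Section independence.
Context {d : measure_display} {T : measurableType d} {R : realType}.
Variable P : probability T R.

Definition mutually_independent_events (I : choiceType) (E : I -> set T) :=
  forall J : {fset I},
    P (\bigcap_(i in [set` J]) E i) = (\prod_(i <- J) P (E i))%E.

Definition mutually_independent (I : choiceType) (d' : measure_display)
    (U : measurableType d') (X : I -> T -> U) :=
  forall A : I -> set U, (forall i, measurable (A i)) ->
    mutually_independent_events (fun i => X i @^-1` A i).

Definition sigma_of_family (I : Type) (d' : measure_display)
    (U : measurableType d') (X : I -> T -> U) : set (set T) :=
  <<s \bigcup_i preimage_set_system setT (X i) measurable >>.

Definition independent_families (I1 I2 : Type) (d1 d2 : measure_display)
    (U1 : measurableType d1) (U2 : measurableType d2)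
    (X : I1 -> T -> U1) (Y : I2 -> T -> U2) :=
  forall A B, sigma_of_family X A -> sigma_of_family Y B ->
    P (A `&` B) = (P A * P B)%E.

End independence.

Section processes.
Context {d : measure_display} {T : measurableType d} {R : realType}.
Variable P : probability T R.

(* Processes on [0, +oo[ are indexed by the whole of R; a Poisson process is
   extended by 0 to negative times. The path properties hold for every outcome
   (a counting process), so that the process can be evaluated at a random time
   without losing measurability. As paths are nondecreasing, the truncated
   subtraction of natural numbers computes the increments. *)
Record poisson_process (rate : R) (N : R -> {RV P >-> nat}) : Prop :=
  PoissonProcess {
    poisson_process_le0 : forall t w, t <= 0 -> N t w = 0%N ;
    poisson_process_nd : forall w s t, s <= t -> (N s w <= N t w)%N ;
    poisson_process_rcont : forall w t, (fun s => N s w) @ t^'+ --> N t w ;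
    poisson_process_indep : forall t : nat -> R,
      0 <= t 0%N -> {homo t : i j / (i <= j)%N >-> i <= j} ->
      mutually_independent P (fun i w => (N (t i.+1) w - N (t i) w)%N) ;
    poisson_process_law : forall s t k, 0 <= s -> s < t ->
      P [set w | (N t w - N s w)%N = k] = (poisson_pmf (rate * (t - s)) k)%:E
  }.

(* The j-th jump, j >= 1, is [xi j.-1]. *)
Definition compound (N : R -> {RV P >-> nat}) (xi : nat -> {RV P >-> R})
    (t : R) (w : T) : R :=
  \sum_(j < N t w) xi j w.

Record compound_poisson_exp (rate beta : R) (N : R -> {RV P >-> nat})
    (xi : nat -> {RV P >-> R}) : Prop := CompoundPoissonExp {
    compound_poisson_process : poisson_process rate N ;
    compound_jump_law : forall j A, measurable A ->
      distribution P (xi j) A = exponential_prob beta A ;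
    compound_jump_indep : mutually_independent P xi ;
    compound_indep : independent_families P N xi
  }.

Definition iterated (N1 : R -> {RV P >-> nat}) (E : R -> T -> R)
    (t : R) (w : T) : nat :=
  N1 (E t w) w.

Definition state_prob (X : R -> T -> nat) (k : nat) (t : R) : R :=
  fine (P [set w | X t w = k]).

End processes.

Section mittag_leffler.
Context {R : realType}.

(* Euler's integral; this is the Gamma function only for x > 0. *)
Definition Gamma (x : R) : R :=
  \int[lebesgue_measure]_(s in `]0, +oo[) (s `^ (x - 1) * expR (- s)).

Definition mittag_leffler3 (rho delta gamma z : R) : R :=
  limn (series (fun j : nat => Gamma (gamma + j%:R) / Gamma gamma *
    (z ^+ j / (j`!%:R * Gamma (rho * j%:R + delta))))).

End mittag_leffler.

(* Main.v *)
Require Import Defs.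
From HB Require Import structures.
From mathcomp Require Import all_boot all_order all_algebra finmap.
From mathcomp Require Import all_classical all_reals all_analysis.
From mathcomp Require Import measurable_realfun ring.
Set Implicit Arguments.
Unset Strict Implicit.
Unset Printing Implicit Defensive.
Import Order.TTheory GRing.Theory Num.Theory.
Import numFieldNormedType.Exports.
Local Open Scope classical_set_scope.
Local Open Scope ring_scope.

(* Write q = lambda1 / (lambda1 + beta) and p = beta / (lambda1 + beta). Given
   N t = n, the process N1 is evaluated at a sum of n independent exponential
   times. N1 at one exponential time is geometric, with weights p q^k, so the
   convolution of n of them has weights 'C(n + k - 1, k) p^n q^k. Mixing over
   the Poisson variable N t yields
     p_k t = e^(- lambda t) q^k sum_n 'C(n + k - 1, k) (lambda p t)^n / n!,
   which is the Mittag-Leffler formula after shifting n by one. The hockey-stick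
   identity sum_(i <= k) 'C(n + i - 1, i) = 'C(n + k, k) serves twice: it is the
   induction step of the convolution, and it expresses the derivative of the
   k-th power series as the sum of the series of index i <= k, which is the
   differential equation. *)

(** * Poisson weights as functions of time, their integrals, and Gamma at integers *)

Section poisson_weight.
Context {R : realType}.
Implicit Types (c x : R) (k : nat).

(** No condition on the sign of [x]: the weight is smooth on the whole line and also covers time
    0. *)
Definition poisson_weight c k x : R :=
  (c * x) ^+ k / k`!%:R * expR (- (c * x)).

Lemma poisson_weight_ge0 c k x : 0 <= c -> 0 <= x -> 0 <= poisson_weight c k x.
Proof. by move=> c0 x0; rewrite !mulr_ge0// ?expR_ge0// exprn_ge0// mulr_ge0. Qed.

Lemma poisson_weight0 c k : poisson_weight c k 0 = (k == 0)%N%:R.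
Proof.
rewrite /poisson_weight mulr0 oppr0 expR0 mulr1 expr0n.
by case: k => [|k]; rewrite ?fact0 ?divr1 ?mul0r.
Qed.

Lemma poisson_pmfE k x : 0 < x -> poisson_pmf x k = poisson_weight 1 k x.
Proof. by move=> x0; rewrite /poisson_pmf x0 /poisson_weight mul1r. Qed.

Lemma poisson_weight_le1 c k x : 0 <= c -> 0 <= x -> poisson_weight c k x <= 1.
Proof.
move=> c0 x0; have cx0 := mulr_ge0 c0 x0.
rewrite /poisson_weight expRN ler_pdivrMr ?expR_gt0// mul1r.
case: k => [|k].
  rewrite expr0 fact0 divr1; apply: le_trans (expR_ge1Dx _).
  by rewrite lerDl.
by apply: le_trans (expR_ge1Dxn k cx0); rewrite lerDr.
Qed.

Lemma is_derive_poisson_weight c k x :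
  is_derive x 1 (poisson_weight c k)
    (c * ((if k is k'.+1 then poisson_weight c k' x else 0) -
          poisson_weight c k x)).
Proof.
rewrite (_ : poisson_weight c k =
    (k`!%:R^-1 \*: (c \*: id) ^+ k) * (expR \o - (c \*: id))); last first.
  apply/funext => y; rewrite /poisson_weight !fctE/= /GRing.scale/=.
  by rewrite [X in X * _ = _]mulrC.
apply: is_derive_eq.
rewrite /= !fctE /GRing.scale/= /GRing.scale/= /poisson_weight !mulr1.
case: k => [|k]; first by rewrite fact0 !expr0; ring.
rewrite factS natrM exprS /=; field.
by rewrite pnatr_eq0 -lt0n fact_gt0 addrC natr1 pnatr_eq0.
Qed.

Lemma continuous_poisson_weight c k : continuous (poisson_weight c k).
Proof.
move=> x; apply: differentiable_continuous; apply/derivable1_diffP.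
by case: (is_derive_poisson_weight c k x).
Qed.

Lemma measurable_poisson_weight c k :
  measurable_fun setT (poisson_weight c k).
Proof.
by apply: continuous_measurable_fun => x; exact: continuous_poisson_weight.
Qed.

(** Consecutive weights differ by the factor [c * x / k.+1%:R], so the bound by 1 at index [k.+1]
    makes the weight of index [k] at most [k.+1%:R / (c * x)]. *)
Lemma cvgy_poisson_weight c k : 0 < c ->
  poisson_weight c k x @[x --> +oo] --> (0 : R).
Proof.
move=> c0; apply: (@squeeze_cvgr _ _ _ _ (cst 0) (fun x => k.+1%:R / c * x^-1)).
- near=> x.
  have x0 : 0 < x by near: x; exact: nbhs_pinfty_gt.
  rewrite (poisson_weight_ge0 _ (ltW c0) (ltW x0))/=.
  have := poisson_weight_le1 k.+1 (ltW c0) (ltW x0).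
  rewrite (_ : poisson_weight c k.+1 x = poisson_weight c k x * (c * x / k.+1%:R)).
    have y0 : 0 < c * x / k.+1%:R by rewrite divr_gt0 ?mulr_gt0 ?ltr0n.
    by rewrite -(ler_pdivlMr _ _ y0) mul1r invf_div invfM mulrA.
  rewrite /poisson_weight factS natrM exprS; field.
  by rewrite pnatr_eq0 -lt0n fact_gt0 addrC natr1 pnatr_eq0.
- exact: cvg_cst.
- rewrite -[X in _ --> X](mulr0 (k.+1%:R / c)); apply: cvgMl_tmp.
  by apply/gtr0_cvgV0; [exact: nbhs_pinfty_gt|exact: cvg_id].
Unshelve. all: by end_near. Qed.

(** The derivative of the weight of index i is [c] times the difference of the weights of indices i
    - 1 and i, so the sum telescopes. *)
Lemma is_derive_sum_poisson_weight c k x : 0 < c ->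
  is_derive x 1 (fun y => - c^-1 * \sum_(i < k.+1) poisson_weight c i y)
    (poisson_weight c k x).
Proof.
move=> c0; elim: k => [|k ih].
  under eq_fun do rewrite big_ord1.
  have d := is_derive_poisson_weight c 0 x.
  rewrite (_ : (fun _ => _) = (- c^-1) \*: poisson_weight c 0)//.
  apply: is_derive_eq; rewrite /GRing.scale/=.
  by field; rewrite gt_eqF.
have d := is_derive_poisson_weight c k.+1 x.
rewrite (_ : (fun _ => _) =
  (fun y => - c^-1 * \sum_(i < k.+1) poisson_weight c i y) +
  (- c^-1) \*: poisson_weight c k.+1); last first.
  by apply/funext => y; rewrite !fctE/= big_ord_recr/= mulrDr.
apply: is_derive_eq; rewrite /GRing.scale/=.
by field; rewrite gt_eqF.
Qed.

(** The antiderivative just found tends to 0 at infinity, and at 0 only its term of index 0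
    survives. *)
Lemma integral_poisson_weight c k : 0 < c ->
  (\int[lebesgue_measure]_(x in `[0%R, +oo[) (poisson_weight c k x)%:E =
   (c^-1)%:E)%E.
Proof.
move=> c0; have dF := is_derive_sum_poisson_weight k _ c0.
rewrite (@ge0_continuous_FTC2y R _
  (fun y => - c^-1 * \sum_(i < k.+1) poisson_weight c i y) _ 0).
- rewrite sub0e -EFinN big_ord_recl poisson_weight0 big1 => [|i _].
    by rewrite addr0 mulr1 opprK.
  by rewrite poisson_weight0.
- by move=> x x0; rewrite poisson_weight_ge0 // ltW.
- by apply: continuous_subspaceT => x; exact: continuous_poisson_weight.
- rewrite -[X in _ --> X](mulr0 (- c^-1)).
  apply: (@cvgMl_tmp _ _ _ _ (fun x => \sum_(i < k.+1) poisson_weight c i x)).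
  elim: k.+1 => [|m ih].
    by under eq_fun do rewrite big_ord0; exact: cvg_cst.
  under eq_fun do rewrite big_ord_recr/=.
  by have := cvgD ih (cvgy_poisson_weight m c0); rewrite addr0; exact.
- by move=> x _; case: (dF x).
- apply: cvg_at_right_filter.
  suff : {for 0, continuous (fun y => - c^-1 * \sum_(i < k.+1) poisson_weight c i y)}.
    exact.
  apply: differentiable_continuous; by apply/derivable1_diffP; case: (dF 0).
- by move=> x _; rewrite derive1E; apply: derive_val.
Qed.

Lemma integral_oo_poisson_weight c k : 0 < c ->
  (\int[lebesgue_measure]_(x in `]0%R, +oo[) (poisson_weight c k x)%:E =
   (c^-1)%:E)%E.
Proof.
move=> c0; rewrite -(integral_poisson_weight k c0) integral_itv_obnd_cbnd//.
apply/measurable_EFinP; apply: measurable_funTS.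
exact: measurable_poisson_weight.
Qed.

(** Euler's integrand is n! times the Poisson weight of rate 1, whose integral is 1. *)
Lemma Gamma_nat n : Gamma n.+1%:R = n`!%:R :> R.
Proof.
rewrite /Gamma /Rintegral.
under eq_integral.
  move=> x; rewrite inE/= in_itv/= andbT => x0.
  rewrite -natr1 addrK powR_mulrn ?ltW//.
  rewrite (_ : _ * _ = n`!%:R * poisson_weight 1 n x); last first.
    rewrite /poisson_weight mul1r; field.
    by rewrite pnatr_eq0 -lt0n fact_gt0.
  rewrite EFinM.
  over.
rewrite ge0_integralZl//=.
- by rewrite integral_oo_poisson_weight// -EFinM invr1 mulr1.
- apply/measurable_EFinP; apply: measurable_funTS.
  exact: measurable_poisson_weight.
- move=> x; rewrite in_itv/= andbT => x0.
  by rewrite lee_fin poisson_weight_ge0 ?ltW.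
Qed.

End poisson_weight.

(** Induction on [k] with Pascal's rule. The term i = 0 is 1 for every [n], so truncating the
    predecessor at n = 0 does no harm. *)
Lemma bin_hockey_stick n k :
  'C(n + k, k) = (\sum_(i < k.+1) 'C((n + i).-1, i))%N.
Proof.
elim: k => [|k ih]; first by rewrite big_ord1 !bin0.
by rewrite big_ord_recr/= -ih addnS binS addnC.
Qed.

(** * Exponential generating series of binomial coefficients *)

Section bin_series.
Context {R : realType}.
Implicit Types (k n : nat) (x : R).

(** Comparison with M exp(2|x|): the factor [2 ^ n] is absorbed into the argument of the exponential
    series. *)
Lemma is_cvg_pseries_bin (c : nat -> nat) M x :
  (forall n, (c n <= M * 2 ^ n)%N) ->
  cvgn (pseries (fun n => (c n)%:R / n`!%:R : R) x).
Proof.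
move=> cM; apply: normed_cvg.
apply: (@series_le_cvg _ _ (M%:R *: exp_coeff (2 * `|x|))).
- by move=> n /=.
- move=> n /=; rewrite fctE /GRing.scale/=.
  by rewrite mulr_ge0// exp_coeff_ge0// mulr_ge0.
- move=> n /=; rewrite fctE /GRing.scale/= /exp_coeff/=.
  rewrite normrM normrX normrM normfV !normr_nat exprMn.
  rewrite [leRHS](_ : _ = M%:R * 2 ^+ n * `|x| ^+ n / n`!%:R); last by ring.
  rewrite mulrAC ler_wpM2r ?invr_ge0// ler_wpM2r ?exprn_ge0//.
  by rewrite -natrX -natrM ler_nat.
- rewrite (_ : series _ = M%:R *: series (exp_coeff (2 * `|x|))).
    by apply: is_cvgZl_tmp; exact: is_cvg_series_exp_coeff.
  apply/funext => n; rewrite /series/= fctE /GRing.scale/= /GRing.scale/= mulr_sumr.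
  by [].
Qed.

(* The truncated predecessor is harmless: at n = 0 the coefficient is
   'C(k.-1, k), which is 1 for k = 0 and 0 otherwise. *)
Definition bin_series k x : R :=
  limn (pseries (fun n => 'C((n + k).-1, k)%:R / n`!%:R) x).

Lemma bin_le_exp2 n k : ('C(n, k) <= 2 ^ n)%N.
Proof.
have [kn|] := leqP k n; last by move=> /bin_small ->.
rewrite -[2%N]/(1 + 1)%N expnDn.
by rewrite (bigD1 (Ordinal (kn : (k < n.+1)%N)))//= !exp1n !muln1 leq_addr.
Qed.

Lemma is_cvg_bin_series k x :
  cvgn (pseries (fun n => 'C((n + k).-1, k)%:R / n`!%:R : R) x).
Proof.
apply: (@is_cvg_pseries_bin _ (2 ^ k)) => n.
rewrite -expnD; apply: leq_trans (bin_le_exp2 _ _) _.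
by rewrite leq_exp2l// addnC leq_pred.
Qed.

Lemma pseries_diffs_fact (c : nat -> R) :
  pseries_diffs (fun n => c n / n`!%:R) = (fun n => c n.+1 / n`!%:R).
Proof.
apply/funext => n; rewrite /pseries_diffs factS natrM; field.
by rewrite pnatr_eq0 -lt0n fact_gt0 addrC natr1 pnatr_eq0.
Qed.

(** Differentiation shifts the coefficients by one; the shifted coefficient ['C(n + k, k)] splits by
    the hockey-stick identity. *)
Lemma is_derive_bin_series k x :
  is_derive x 1 (bin_series k) (\sum_(i < k.+1) bin_series i x).
Proof.
have -> : \sum_(i < k.+1) bin_series i x =
    limn (pseries (pseries_diffs (fun n => 'C((n + k).-1, k)%:R / n`!%:R)) x).
  rewrite pseries_diffs_fact.
  rewrite (_ : pseries _ x = \sum_(i < k.+1)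
      pseries (fun n => 'C((n + i).-1, i)%:R / n`!%:R) x); last first.
    apply/funext => n; rewrite fct_sumE /pseries /series/= exchange_big/=.
    apply: eq_bigr => j _; rewrite bin_hockey_stick natr_sum.
    by rewrite !mulr_suml.
  apply/esym/cvg_lim => //; elim: k.+1 => [|m ih].
    by rewrite !big_ord0; exact: cvg_cst.
  rewrite !big_ord_recr/=; apply: cvgD => //; exact: is_cvg_bin_series.
(* Termwise differentiation asks for convergence of the series and of its first two derived series
   at a point of modulus larger than |x|. *)
apply: (@pseries_snd_diffs _ _ (`|x| + 1)).
- exact: is_cvg_bin_series.
- rewrite pseries_diffs_fact.
  apply: (@is_cvg_pseries_bin _ (2 ^ k)) => n.
  rewrite -expnD; apply: leq_trans (bin_le_exp2 _ _) _.
  by rewrite leq_exp2l// addnC//= ?addnS ?addSn.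
- rewrite !pseries_diffs_fact.
  apply: (@is_cvg_pseries_bin _ (2 ^ k.+1)) => n.
  rewrite -expnD; apply: leq_trans (bin_le_exp2 _ _) _.
  by rewrite leq_exp2l// addnC//= ?addnS ?addSn.
- by rewrite [ltRHS]ger0_norm ?addr_ge0// ltrDl.
Qed.

End bin_series.

(** * The link with the Mittag-Leffler function *)

Section mittag_leffler_bin_series.
Context {R : realType}.

(** The Gamma values are factorials, so the coefficient of z^j on the left is ['C(j + k, k)] / (j +
    1)!, which is the coefficient of index j + 1 of [bin_series k]. The coefficient of index 0 of
    that series vanishes because k >= 1. *)
Lemma mittag_leffler3_bin_series k (z : R) : (1 <= k)%N ->
  z * mittag_leffler3 1 2 k.+1%:R z = bin_series k z.
Proof.
move=> k1; pose u n : R := 'C((n + k).-1, k)%:R / n`!%:R * z ^+ n.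
have u0 : u 0%N = 0 by rewrite /u bin_small ?mul0r// add0n prednK.
have cu : series u n @[n --> \oo] --> bin_series k z by exact: is_cvg_bin_series.
rewrite /mittag_leffler3; set v := (X in series X).
have uE n : series u n.+1 = z * series v n.
  rewrite /series/= big_nat_recl// u0 add0r mulr_sumr; apply: eq_bigr => j _.
  rewrite /u /v mul1r -natrD !addSn -(natrD _ j 2) !addn2 !Gamma_nat.
  have kj : ('C(j + k, k))%:R = (k + j)`!%:R / (k`!%:R * j`!%:R) :> R.
    have /(congr1 (fun n => n%:R : R)) := bin_fact (leq_addl j k).
    rewrite addnK natrM [(k + j)%N]addnC => <-.
    by rewrite natrM mulfK// -natrM pnatr_eq0 -lt0n muln_gt0 !fact_gt0.
  rewrite kj exprS; field.
  by rewrite !pnatr_eq0 -!lt0n !fact_gt0.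
move: cu; rewrite -cvg_shiftS => cu.
(* Below, the series is recovered through division by [z]. At z = 0 the left side is 0, and so are
   the partial sums on the right. *)
have [z0|z0] := eqVneq z 0.
  rewrite [LHS](_ : _ = 0); last by rewrite z0 mul0r.
  apply: (@cvg_unique _ _ _ _ _ _ _ cu) => //=.
  rewrite [X in X @ _](_ : _ = cst 0); first exact: cvg_cst.
  by apply/funext => n; rewrite /= uE z0 mul0r.
have -> : limn (series v) = z^-1 * bin_series k z; last by rewrite mulVKf.
apply/cvg_lim => //.
have -> : series v = (fun n => z^-1 * series u n.+1).
  by apply/funext => n; rewrite uE mulKf.
exact: cvgMl_tmp.
Qed.

End mittag_leffler_bin_series.

(** * The closed form of the state probabilities and its differential equation *)

Section closed_form.
Context {R : realType}.
Variables (lambda p q : R).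

Definition closed_form k t : R :=
  expR (- (lambda * t)) * q ^+ k * bin_series k (lambda * p * t).

Lemma closed_form_series k t :
  (\sum_(0 <= n <oo) (poisson_weight lambda n t *
     ('C((n + k).-1, k)%:R * p ^+ n * q ^+ k))%:E)%E = (closed_form k t)%:E.
Proof.
rewrite /closed_form /bin_series; set u := pseries _ _.
have cu : cvgn u by exact: is_cvg_bin_series.
apply/cvg_lim => //.
rewrite [X in X @ _ --> _](_ : _ =
    EFin \o (fun n => expR (- (lambda * t)) * q ^+ k * u n)); last first.
  apply/funext => n /=.
  rewrite sumEFin; congr EFin; rewrite /u /pseries /series/= mulr_sumr.
  by apply: eq_bigr => i _; rewrite /poisson_weight !exprMn; ring.
apply: cvg_EFin; first exact: nearW.
exact: cvgMl_tmp.
Qed.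

Lemma closed_form0 t : closed_form 0 t = expR (- (lambda * (1 - p) * t)).
Proof.
rewrite /closed_form expr0 mulr1.
rewrite (_ : bin_series 0 _ = expR (lambda * p * t)).
  by rewrite -expRD; congr expR; ring.
rewrite expRE /bin_series; congr (limn _); apply/funext => n.
by rewrite /pseries /series/=; apply: eq_bigr => i _; rewrite bin0 div1r.
Qed.

Lemma closed_form_mittag_leffler k t : (1 <= k)%N ->
  closed_form k t = expR (- (lambda * t)) * q ^+ k * (lambda * p * t) *
    mittag_leffler3 1 2 k.+1%:R (lambda * p * t).
Proof. by move=> k1; rewrite -mulrA mittag_leffler3_bin_series. Qed.

(** Product rule: the exponential contributes - lambda and the summand i = k of the derived series
    contributes lambda p, together - lambda q. The summands i < k form the sum over m = k - i. *)
Lemma is_derive_closed_form k (t : R) : p + q = 1 ->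
  is_derive t 1 (closed_form k)
    (- lambda * q * closed_form k t +
     lambda * p * \sum_(1 <= m < k.+1) q ^+ m * closed_form (k - m) t).
Proof.
move=> pq.
have dS := is_derive_bin_series k (lambda * p * t).
rewrite (_ : closed_form k = (q ^+ k \*: (expR \o - (lambda \*: id))) *
   (bin_series k \o ((lambda * p) \*: id))); last first.
  apply/funext => x; rewrite /closed_form !fctE/= /GRing.scale/=.
  by rewrite mulrC [X in _ * X]mulrC mulrC.
apply: is_derive_eq.
have -> : \sum_(i < k.+1) bin_series i (lambda * p * t) =
    bin_series k (lambda * p * t) +
    \sum_(1 <= m < k.+1) bin_series (k - m) (lambda * p * t).
  rewrite (reindex_inj rev_ord_inj)/= -(big_mkord xpredT (fun i => bin_series (k.+1 - i.+1) _)).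
  by rewrite big_ltn// subSS subn0.
rewrite !fctE /GRing.scale/= /GRing.scale/= !mulr1.
have -> : \sum_(1 <= m < k.+1) q ^+ m * closed_form (k - m) t =
    q ^+ k * expR (- (lambda * t)) *
    \sum_(1 <= m < k.+1) bin_series (k - m) (lambda * p * t).
  rewrite mulr_sumr; apply: eq_big_nat => m /andP[_]; rewrite ltnS => mk.
  have -> : q ^+ k = q ^+ (k - m) * q ^+ m by rewrite -exprD subnK.
  by rewrite /closed_form; ring.
have -> : p = 1 - q by rewrite -pq addrK.
by ring.
Qed.

End closed_form.

(** * Transfer of integrals along a weighted measurable map *)

(* With X = id, W is a density of m2 with respect to m1 (up to c); with W an
   indicator function or a product of functions of other random variables, the
   hypothesis XW expresses independence from X. *)
Section integral_transfer.
Local Open Scope ereal_scope.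
Context {R : realType} {d1 d2 : measure_display}.
Context {T1 : measurableType d1} {T2 : measurableType d2}.
Variables (m1 : {measure set T1 -> \bar R}) (m2 : {measure set T2 -> \bar R}).
Variables (X : T1 -> T2) (W : T1 -> R) (c : R).
Hypotheses (mX : measurable_fun setT X) (mW : measurable_fun setT W).
Hypothesis W0 : forall x, (0 <= W x)%R.
Hypothesis XW : forall C, measurable C ->
  \int[m1]_(x in X @^-1` C) (W x)%:E = c%:E * m2 C.

Import HBNNSimple.

(** Linearity reduces a simple function to its level sets, where [XW] applies. *)
Let integral_transfer_nnsfun (h : {nnsfun T2 >-> R}) :
  \int[m1]_x ((W x)%:E * (h (X x))%:E) = c%:E * \int[m2]_y (h y)%:E.
Proof.
have mXh r : measurable (X @^-1` (h @^-1` [set r])).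
  by rewrite -[X in measurable X]setTI; exact: mX.
under eq_integral.
  move=> x _; rewrite fimfunE -fsumEFin// ge0_mule_fsumr; last first.
    by move=> r; rewrite EFinM nnfun_muleindic_ge0.
  over.
rewrite ge0_integral_fsum//; last 2 first.
  - move=> r; apply: emeasurable_funM; first exact/measurable_EFinP.
    apply/measurable_EFinP; apply: measurable_funM => //.
    by apply: measurableT_comp mX; exact: measurable_indic.
  - by move=> r x _; apply: mule_ge0; rewrite ?EFinM ?nnfun_muleindic_ge0// lee_fin.
under [in RHS]eq_integral do rewrite fimfunE -fsumEFin//.
rewrite ge0_integral_fsum//; last 2 first.
  - by move=> r; exact/measurable_EFinP/measurableT_comp.
  - by move=> r x _; rewrite EFinM nnfun_muleindic_ge0.
rewrite ge0_mule_fsumr; last first.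
  move=> r; apply: integral_ge0 => x _; by rewrite EFinM nnfun_muleindic_ge0.
apply: eq_fsbigr => r _.
(* A negative [r] is not a value of [h], so both sides vanish; a nonnegative one can be pulled out
   of the integrals. *)
have [r0|r0] := ltP r 0%R.
  rewrite !integral0_eq ?mule0//.
  - by move=> x _; rewrite preimage_nnfun0// indic0 mulr0.
  - by move=> x _; rewrite preimage_nnfun0// indic0 mulr0 mule0.
transitivity (r%:E * \int[m1]_(x in X @^-1` (h @^-1` [set r])) (W x)%:E).
  rewrite -ge0_integralZl//; last 2 first.
  - by apply: measurable_funTS; exact/measurable_EFinP.
  - by move=> x _; rewrite lee_fin.
  rewrite [RHS]integral_mkcond; apply: eq_integral => x _.
  rewrite patchE indicE; have [xr|xr] := pselect (h (X x) = r).
    by rewrite !mem_set// mulr1 muleC.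
  by rewrite !memNset// mulr0 mule0.
rewrite XW//.
under [in RHS]eq_integral do rewrite EFinM.
rewrite ge0_integralZl//; last exact/measurable_EFinP.
by rewrite integral_indic// setIT muleCA.
Qed.

Lemma integral_transfer (f : T2 -> \bar R) : measurable_fun setT f ->
  (forall y, 0 <= f y) ->
  \int[m1]_x ((W x)%:E * f (X x)) = c%:E * \int[m2]_y f y.
Proof.
move=> mf f0; pose f_ := nnsfun_approx measurableT mf.
have f_f y : EFin \o f_ ^~ y @ \oo --> f y by exact: cvg_nnsfun_approx.
have f_nd y : {homo f_ ^~ y : m n / (m <= n)%N >-> (m <= n)%R}.
  by move=> m n mn; exact/lefP/nd_nnsfun_approx.
transitivity (limn (fun n => \int[m1]_x ((W x)%:E * (f_ n (X x))%:E))).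
  rewrite -monotone_convergence//=.
  - apply: eq_integral => x _; apply/esym/cvg_lim => //.
    by apply: cvgeMl => //; exact: f_f.
  - move=> n; apply: emeasurable_funM; first exact/measurable_EFinP.
    by apply/measurable_EFinP; exact: measurableT_comp.
  - by move=> n x _; rewrite mule_ge0 ?lee_fin.
  - by move=> x _ m n mn; rewrite lee_pmul ?lee_fin// f_nd.
transitivity (limn (fun n => c%:E * \int[m2]_y (f_ n y)%:E)).
  by congr (limn _); apply/funext => n; exact: integral_transfer_nnsfun.
rewrite limeMl//; last first.
  apply/ereal_nondecreasing_is_cvgn => m n mn; apply: ge0_le_integral => //.
  - by move=> x _; rewrite lee_fin.
  - exact/measurable_EFinP.
  - exact/measurable_EFinP.
  - by move=> x _; rewrite lee_fin f_nd.
congr (_ * _); rewrite -monotone_convergence//=.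
- by apply: eq_integral => x _; apply/cvg_lim => //; exact: f_f.
- by move=> n; exact/measurable_EFinP.
- by move=> n x _; rewrite lee_fin.
- by move=> x _ m n mn; rewrite lee_fin f_nd.
Qed.

End integral_transfer.

(** * Poisson weights at an exponential time *)

Section exponential_poisson_weight.
Context {R : realType}.

(* This is P (N x = k) for every real x, as N vanishes at negative times. *)
Definition pos_poisson_weight (c : R) k (x : R) : R :=
  poisson_weight c k (Num.max 0 x).

Lemma pos_poisson_weight_ge0 c k x : 0 <= c -> 0 <= pos_poisson_weight c k x.
Proof. by move=> c0; rewrite poisson_weight_ge0// le_max lexx. Qed.

Lemma measurable_pos_poisson_weight (c : R) k :
  measurable_fun setT (pos_poisson_weight c k).
Proof.
apply: (measurableT_comp (measurable_poisson_weight c k)).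
exact: measurable_maxr.
Qed.

(** Convolution of Poisson laws, by the binomial theorem. It serves to split the last jump off a sum
    of jumps. *)
Lemma pos_poisson_weightD (c : R) k x y : 0 <= x -> 0 <= y ->
  pos_poisson_weight c k (x + y) =
  \sum_(i < k.+1) pos_poisson_weight c i x * pos_poisson_weight c (k - i) y.
Proof.
move=> x0 y0; rewrite /pos_poisson_weight !max_r ?addr_ge0//.
rewrite /poisson_weight mulrDr opprD expRD addrC exprDn !mulr_suml.
apply: eq_bigr => i _; have ik : (i <= k)%N by rewrite -ltnS.
rewrite -mulr_natr.
have /(congr1 (fun n => n%:R : R)) := bin_fact ik.
rewrite !natrM => kE.
have -> : 'C(k, i)%:R = k`!%:R / (i`!%:R * (k - i)`!%:R) :> R.
  by rewrite -kE mulfK// -natrM pnatr_eq0 -lt0n muln_gt0 !fact_gt0.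
by field; rewrite !pnatr_eq0 -!lt0n !fact_gt0.
Qed.

(** On the half-line, the exponential density times the weight of rate [c] is a constant multiple of
    the weight of rate [c + b], whose integral is known. The result is a geometric law. *)
Lemma integral_exponential_poisson_weight (c b : R)
    (mu : {measure set R -> \bar R}) k : 0 <= c -> 0 < b ->
  (forall A, measurable A -> mu A = exponential_prob b A) ->
  (\int[mu]_x (pos_poisson_weight c k x)%:E =
   (b / (c + b) * (c / (c + b)) ^+ k)%:E)%E.
Proof.
move=> c0 b0 muE.
have cb0 : 0 < c + b by rewrite ltr_wpDl.
have h0 x := @pos_poisson_weight_ge0 c k x c0.
rewrite (_ : (\int[mu]_x _)%E = (\int[lebesgue_measure]_x
    ((exponential_pdf b x)%:E * (pos_poisson_weight c k x)%:E))%E); last first.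
  rewrite -[LHS]mul1e; apply/esym.
  apply: (@integral_transfer _ _ _ _ _ lebesgue_measure mu id) => //.
  - exact: measurable_exponential_pdf.
  - by move=> x; rewrite exponential_pdf_ge0 ?ltW.
  - by move=> A mA; rewrite mul1e muE.
  - by apply/measurable_EFinP; exact: measurable_pos_poisson_weight.
under eq_integral.
  move=> x _.
  rewrite (_ : (_ * _)%E = ((fun x => (b * (c / (c + b)) ^+ k)%:E *
      (poisson_weight (c + b) k x)%:E) \_ `[0%R, +oo[) x)%E; last first.
    rewrite patchE /pos_poisson_weight mem_setE/= in_itv/= andbT.
    case: ifPn => x0; last by rewrite lt0_exponential_pdf ?mul0e// ltNge.
    rewrite (max_r x0).
    rewrite exponential_pdfE// -!EFinM; congr EFin.
    rewrite /poisson_weight.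
    have -> : expR (- ((c + b) * x)) = expR (- b * x) * expR (- (c * x)).
      by rewrite -expRD; congr expR; ring.
    rewrite !exprMn exprVn; field.
    by rewrite expf_neq0 ?gt_eqF// pnatr_eq0 -lt0n fact_gt0.
  over.
rewrite -integral_mkcond ge0_integralZl//=.
- by rewrite integral_poisson_weight// -EFinM; congr EFin; rewrite mulrAC.
- by apply: measurable_funTS; apply/measurable_EFinP; exact: measurable_poisson_weight.
- by move=> x; rewrite in_itv/= andbT => x0; rewrite lee_fin poisson_weight_ge0// (ltW cb0).
- by rewrite lee_fin mulr_ge0 ?exprn_ge0 ?divr_ge0// ltW.
Qed.

End exponential_poisson_weight.

(** * Negative binomial weights from a sum of independent exponential jumps *)

Section sum_of_jumps.
Context {R : realType} {d : measure_display} {T : measurableType d}.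
Variables (P : probability T R) (xi : nat -> {RV P >-> R}) (c b : R).
Hypotheses (c_ge0 : 0 <= c) (b_gt0 : 0 < b).
Hypothesis jump_law : forall j A, measurable A ->
  distribution P (xi j) A = exponential_prob b A.
Hypothesis jump_indep : mutually_independent P xi.

Let S n w := \sum_(j < n) xi j w.

Let h k x := pos_poisson_weight c k x.

Lemma measurable_sum_jumps n : measurable_fun setT (S n).
Proof. by apply: measurable_sum => j; exact: measurable_funPT. Qed.

(** The law of a jump controls its sign almost surely, which is enough to use the convolution
    identity under the integral. *)
Lemma jumps_ge0 : {ae P, forall w, forall j, 0 <= xi j w}.
Proof.
apply: ae_foralln => j; exists (xi j @^-1` `]-oo, 0[); split.
- by rewrite -[X in measurable X]setTI; exact: measurable_funPT.
- rewrite -[LHS]/(distribution P (xi j) `]-oo, 0[%classic) jump_law//.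
  rewrite /exponential_prob integral0_eq// => x; rewrite /= in_itv/= => x0.
  by rewrite lt0_exponential_pdf.
- by move=> w /= /negP; rewrite -ltNge in_itv.
Qed.

Let mh k (f : T -> R) : measurable_fun setT f -> measurable_fun setT (h k \o f).
Proof. exact: measurableT_comp (measurable_pos_poisson_weight c k). Qed.

Let p := b / (c + b).
Let q := c / (c + b).

(* The events on the jumps of index at least n carry the independence of the
   n-th jump from the sum of the previous ones through the induction on n. *)
Lemma integral_sum_jumps_indep n k (J : {fset nat}) (B : nat -> set R) :
  (forall j, measurable (B j)) -> (forall j, j \in J -> (n <= j)%N) ->
  (\int[P]_(w in \bigcap_(j in [set` J]) (xi j @^-1` B j)) (h k (S n w))%:E =
   ('C((n + k).-1, k)%:R * p ^+ n * q ^+ k *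
     \prod_(j <- J) fine (P (xi j @^-1` B j)))%:E)%E.
Proof.
have mxiB (A : nat -> set R) j : (forall j, measurable (A j)) ->
    measurable (xi j @^-1` A j).
  by move=> mA; rewrite -[X in measurable X]setTI; exact: measurable_funPT.
have mJ (A : nat -> set R) (K : {fset nat}) : (forall j, measurable (A j)) ->
    measurable (\bigcap_(j in [set` K]) (xi j @^-1` A j)).
  by move=> mA; apply: bigcap_measurableType => j _; exact: mxiB.
elim: n k J B => [|n ih] k J B mB Jn.
  (* At the empty sum the weight is 1 for k = 0 and 0 otherwise, in accordance with ['C(k.-1, k)];
     mutual independence handles the events. *)
  rewrite (eq_integral (fun=> (k == 0)%N%:R%:E)); last first.
    move=> w _; rewrite /S big_ord0 /h /pos_poisson_weight max_r//.
    by rewrite poisson_weight0.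
  rewrite integral_cst; last exact: mJ.
  rewrite [X in (_ * X)%E](_ : _ = (\prod_(j <- J) P (xi j @^-1` B j))%E);
    last exact: jump_indep mB J.
  rewrite expr0 mulr1 add0n EFinM.
  congr (_ * _)%E.
    by case: k => [|k]; rewrite ?expr0 ?mulr1// bin_small ?mul0r.
  rewrite -prodEFin; apply: eq_bigr => j _.
  by rewrite fineK// fin_num_measure//; exact: mxiB.
pose D := \bigcap_(j in [set` J]) (xi j @^-1` B j).
have mD : measurable D by exact: mJ.
pose pr := \prod_(j <- J) fine (P (xi j @^-1` B j)).
transitivity (\int[P]_(w in D)
    \sum_(i < k.+1) (h i (S n w) * h (k - i) (xi n w))%:E)%E.
  apply: ge0_ae_eq_integral => //.
  - by apply: measurable_funTS; apply/measurable_EFinP; apply: mh; exact: measurable_sum_jumps.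
  - apply: emeasurable_sum => i; apply: measurable_funTS; apply/measurable_EFinP.
    apply: measurable_funM; apply: mh; first exact: measurable_sum_jumps.
    exact: measurable_funPT.
  - by move=> w _; rewrite lee_fin pos_poisson_weight_ge0.
  - by move=> w _; apply: sume_ge0 => i _; rewrite lee_fin mulr_ge0// pos_poisson_weight_ge0.
  - apply: filterS jumps_ge0 => w xi0 _.
    by rewrite /S big_ord_recr/= {1}/h pos_poisson_weightD// ?sumr_ge0// sumEFin.
rewrite ge0_integral_sum//; last 2 first.
  - move=> i; apply: measurable_funTS; apply/measurable_EFinP.
    apply: measurable_funM; apply: mh; first exact: measurable_sum_jumps.
    exact: measurable_funPT.
  - by move=> i w _; rewrite lee_fin mulr_ge0// pos_poisson_weight_ge0.
(* [(n.+1 + k).-1] is n + k, so the hockey-stick identity lets both sides be compared term by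
   term. *)
rewrite addSn/= bin_hockey_stick natr_sum !mulr_suml -sumEFin.
apply: eq_bigr => i _; have ik : (i <= k)%N by rewrite -ltnS.
rewrite integral_mkcond.
pose W := (h i \o S n) \_ D.
have W0 w : 0 <= W w.
  by rewrite /W patchE; case: ifPn => // _; exact: pos_poisson_weight_ge0.
rewrite (eq_integral (fun w => (W w)%:E * (h (k - i) (xi n w))%:E)%E); last first.
  by move=> w _; rewrite /W !patchE; case: ifPn => //; rewrite mul0e.
(* Transfer along the jump [xi n]; the weight [W] collects the previous jumps and the later events
   in [D]. *)
rewrite (@integral_transfer _ _ _ _ _ P (distribution P (xi n)) (xi n) W
  ('C((n + i).-1, i)%:R * p ^+ n * q ^+ i * pr) _ _ W0 _ (EFin \o h (k - i)%N)).
- rewrite (integral_exponential_poisson_weight (c := c) (b := b))//; last exact: jump_law.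
  rewrite -EFinM; congr EFin; rewrite -/p -/q -/pr.
  have -> : q ^+ k = q ^+ (k - i) * q ^+ i by rewrite -exprD subnK.
  by rewrite exprS; ring.
- exact: measurable_funPT.
- apply/(measurable_restrictT _ mD); apply: measurable_funTS; apply: mh.
  exact: measurable_sum_jumps.
- move=> C mC.
  have nJ : n \notin J by apply/negP => /Jn; rewrite ltnn.
  (* Adding the event on [xi n] to those indexed by [J] gives a family to which the induction
     hypothesis applies; it yields the product form required by the transfer. *)
  pose B' j := if j == n then C else B j.
  have mB' j : measurable (B' j) by rewrite /B'; case: ifPn.
  have J'n j : j \in (n |` J)%fset -> (n <= j)%N.
    by rewrite in_fset1U => /orP[/eqP->//|/Jn/ltnW].
  have BJ j : j \in J -> B' j = B j.
    by rewrite /B' => jJ; case: eqP => // jn; move: nJ; rewrite -jn jJ.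
  have B'n : B' n = C by rewrite /B' eqxx.
  have := ih i (n |` J)%fset B' mB' J'n.
  rewrite big_fsetU1//= B'n.
  have -> : \prod_(j <- J) fine (P (xi j @^-1` B' j)) = pr.
    by apply: eq_big_seq => j jJ; rewrite BJ.
  have -> : \bigcap_(j in [set` (n |` J)%fset]) (xi j @^-1` B' j) =
      D `&` (xi n @^-1` C).
    apply/seteqP; split => [w Bw|w [Dw Cw] j /=].
      split.
        move=> j/= jJ; rewrite -(BJ _ jJ); apply: Bw => /=.
        by rewrite in_fset1U jJ orbT.
      have := Bw n; rewrite /= B'n; apply.
      by rewrite in_fset1U eqxx.
    rewrite in_fset1U => /orP[/eqP ->|jJ]; first by rewrite B'n.
    by rewrite (BJ _ jJ); exact: Dw.
  move=> e.
  rewrite (eq_integral ((EFin \o h i \o S n) \_ D)); last first.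
    by move=> w _; rewrite /W !patchE; case: ifPn.
  rewrite -integral_mkcondr setIC e.
  rewrite -[distribution P (xi n) C]fineK ?fin_num_measure//.
  by rewrite -EFinM; congr EFin; rewrite mulrCA mulrC.
- by apply/measurable_EFinP; exact: measurable_pos_poisson_weight.
- by move=> x; rewrite lee_fin pos_poisson_weight_ge0.
Qed.

Lemma integral_sum_jumps n k :
  (\int[P]_w (h k (\sum_(j < n) xi j w))%:E =
   ('C((n + k).-1, k)%:R * p ^+ n * q ^+ k)%:E)%E.
Proof.
have := @integral_sum_jumps_indep n k fset0 (fun=> setT) (fun=> measurableT).
rewrite big_seq_fset0 mulr1 [X in (\int[P]_(w in X) _)%E](_ : _ = setT); last first.
  by apply/seteqP; split => // w _ j /=; rewrite inE.
by apply => j; rewrite inE.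
Qed.

End sum_of_jumps.

(** * A Poisson process evaluated at an independent random time *)

Section random_time.
Context {R : realType} {d : measure_display} {T : measurableType d}.
Variables (P : probability T R) (rate : R) (N : R -> {RV P >-> nat}).
Hypotheses (rate_gt0 : 0 < rate) (N_poisson : poisson_process rate N).
Variable E : T -> R.
Hypothesis mE : measurable_fun setT E.
Hypothesis EN_indep : forall C s k, measurable C ->
  P (E @^-1` C `&` [set w | N s w = k]) =
  (P (E @^-1` C) * P [set w | N s w = k])%E.

(** [N] is 0 at time 0, so [N s] is an increment; s = 0 is apart because the law of increments
    concerns nonempty intervals. *)
Lemma poisson_process_marginal s k : 0 <= s ->
  P [set w | N s w = k] = (poisson_weight rate k s)%:E.
Proof.
rewrite le_eqVlt => /predU1P[<-|s0].
  rewrite poisson_weight0; case: k => [|k].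
    rewrite [X in P X](_ : _ = setT) ?probability_setT//.
    by apply/seteqP; split => // w _ /=; rewrite (poisson_process_le0 N_poisson).
  rewrite [X in P X](_ : _ = set0) ?measure0//.
  by apply/seteqP; split => // w /=; rewrite (poisson_process_le0 N_poisson).
have := poisson_process_law N_poisson k (lexx 0) s0.
rewrite subr0 poisson_pmfE ?mulr_gt0// /poisson_weight mul1r => <-.
congr (P _); apply/seteqP; split => w /=.
  by rewrite (poisson_process_le0 N_poisson w (lexx 0)) subn0.
by rewrite (poisson_process_le0 N_poisson w (lexx 0)) subn0.
Qed.

(* Paths are only right-continuous, so E is approximated strictly from above,
   by random times with countably many values. *)
Let grid m w : nat := Num.truncn (E w * m.+1%:R).
Let up m j : R := j.+1%:R / m.+1%:R.

(** A negative number truncates to 0, so these times approximate the positive part of [E w]. *)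
Let up_gt m w : Num.max 0 (E w) < up m (grid m w).
Proof.
have [E0|E0] := leP 0 (E w); first by rewrite /up ltr_pdivlMr// truncnS_gt.
by rewrite /up divr_gt0.
Qed.

Let up_le m w : up m (grid m w) <= Num.max 0 (E w) + m.+1%:R^-1.
Proof.
rewrite /up -natr1 mulrDl mul1r lerD2r ler_pdivrMr// /grid.
have [E0|E0] := leP 0 (E w); first by rewrite truncn_le mulr_ge0.
have /truncn0Pn -> : ~~ (1 <= E w * m.+1%:R); last by rewrite mul0r.
by rewrite -ltNge (lt_trans _ ltr01)// pmulr_llt0.
Qed.

Let up_cvg w : up m (grid m w) @[m --> \oo] --> (Num.max 0 (E w))^'+.
Proof.
move=> U [e /= e0 eU].
suff : \forall m \near \oo, U (up m (grid m w)) by [].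
near=> m; apply: eU => /=; last exact: up_gt.
rewrite /ball/= distrC ger0_norm ?subr_ge0 ?(ltW (up_gt _ _))//.
apply: (@le_lt_trans _ _ m.+1%:R^-1).
  by rewrite lerBlDl; exact: up_le.
by near: m; exact: (near_infty_natSinv_lt (PosNum e0)).
Unshelve. all: by end_near. Qed.

Let measurable_truncn j : measurable [set y : R | Num.truncn y = j].
Proof.
case: j => [|j].
  rewrite [X in measurable X](_ : _ = `]-oo, 1[%classic)//.
  apply/seteqP; split => y /=; rewrite in_itv/=.
    by move=> y0; rewrite -(truncn_le_nat y 0) y0.
  by rewrite -(truncn_le_nat y 0) leqn0 => /eqP.
rewrite [X in measurable X](_ : _ = `[j.+1%:R, j.+2%:R[%classic)//.
apply/seteqP; split => y /=; rewrite in_itv/= -truncn_gt_nat -truncn_le_nat.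
  by move=> ->; rewrite leqnn.
by rewrite -eqn_leq => /eqP.
Qed.

Let gridE m j : [set w | grid m w = j] =
  E @^-1` ((fun x => x * m.+1%:R) @^-1` [set y : R | Num.truncn y = j]).
Proof. by []. Qed.

Let measurable_scaled m j :
  measurable ((fun x : R => x * m.+1%:R) @^-1` [set y : R | Num.truncn y = j]).
Proof. by rewrite -[X in measurable X]setTI; exact: mulrr_measurable. Qed.

Let measurable_grid m j : measurable [set w | grid m w = j].
Proof.
by rewrite gridE -[X in measurable X]setTI; apply: mE => //; exact: measurable_scaled.
Qed.

Let measurable_grid_comp m (g : nat -> R) : measurable_fun setT (g \o grid m).
Proof.
move=> _ B _; rewrite setTI [X in measurable X](_ : _ =
  \bigcup_(j in [set j | B (g j)]) [set w | grid m w = j]).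
  by apply: bigcup_measurable => j _; exact: measurable_grid.
apply/seteqP; split => [w Bw|w [j Bj wj]]; first by exists (grid m w).
by rewrite /= wj.
Qed.

Let mN s k : measurable [set w | N s w = k].
Proof. exact: (measurable_funPTI (N s) (Y := [set k])). Qed.

Lemma poisson_process_max0 s w : N (Num.max 0 s) w = N s w.
Proof.
have [//|s0] := leP 0 s.
by rewrite !(poisson_process_le0 N_poisson)// ltW.
Qed.

(** Where the grid index is [j], the process is taken at the deterministic time [up m j], and
    independence factors the probability. *)
Let integral_grid m k :
  (\int[P]_w (poisson_weight rate k (up m (grid m w)))%:E)%E =
  P [set w | N (up m (grid m w)) w = k].
Proof.
pose G j := [set w | grid m w = j].
have tG : trivIset setT G by exact: (@trivIset_preimage1 _ _ setT (grid m)).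
have UG : setT = \bigcup_j G j by apply/seteqP; split => // w _; exists (grid m w).
have up0 j : 0 <= up m j by rewrite divr_ge0.
have -> : [set w | N (up m (grid m w)) w = k] =
    \bigcup_j (G j `&` [set w | N (up m j) w = k]).
  by apply/seteqP; split=> [w Aw|w [j _ [<-]]//]; exists (grid m w).
rewrite measure_bigcup//; last 2 first.
  by move=> j _; apply: measurableI; [exact: measurable_grid|exact: mN].
  exact: trivIset_setIr.
have mpw : measurable_fun setT (fun w => (poisson_weight rate k (up m (grid m w)))%:E).
  apply/measurable_EFinP.
  exact: (measurable_grid_comp m (fun j => poisson_weight rate k (up m j))).
rewrite UG ge0_integral_bigcup//; last 3 first.
  by move=> j; exact: measurable_grid.
  by rewrite -UG.
  by move=> w _; rewrite lee_fin poisson_weight_ge0// ltW.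
rewrite [RHS](@eq_eseriesl _ _ xpredT) => [|j]; last by rewrite in_setT.
apply: eq_eseriesr => j _.
rewrite (eq_integral (fun=> (poisson_weight rate k (up m j))%:E)); last first.
  by move=> w; rewrite inE /G /= => ->.
rewrite integral_cst//; last exact: measurable_grid.
rewrite muleC -poisson_process_marginal//; apply/esym.
exact: EN_indep (measurable_scaled m j).
Qed.

(** Dominated convergence on both sides of [integral_grid]: the probabilities converge by
    right-continuity of the paths, the integrals by continuity of the weight. *)
Lemma poisson_process_random_time k :
  P [set w | N (E w) w = k] = (\int[P]_w (pos_poisson_weight rate k (E w))%:E)%E.
Proof.
pose A m := [set w | N (up m (grid m w)) w = k].
have AE m : A m = \bigcup_j ([set w | grid m w = j] `&` [set w | N (up m j) w = k]).
  by apply/seteqP; split=> [w Aw|w [j _ [<-]]//]; exists (grid m w).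
have mA m : measurable (A m).
  by rewrite AE; apply: bigcup_measurable => j _; apply: measurableI.
have A_cvg w : (\1_(A m) w : R) @[m --> \oo] --> (\1_[set w | N (E w) w = k] w : R).
  apply: cvg_near_cst.
  have rc : N s w @[s --> (Num.max 0 (E w))^'+] --> N (Num.max 0 (E w)) w.
    exact: (poisson_process_rcont N_poisson).
  have := cvg_comp _ _ (@up_cvg w) rc.
  (* Convergence of natural numbers is eventual equality, so the indicators are eventually
     constant. *)
  move=> /discrete_cvg; rewrite poisson_process_max0 => NE.
  near=> m; rewrite !indicE; congr (_%:R); congr nat_of_bool.
  have NmE : N (up m (grid m w)) w = N (E w) w by near: m; exact: NE.
  by apply/idP/idP; rewrite !inE /A /= NmE.
(* The event at the random time is measurable because its indicator is a pointwise limit of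
   measurable ones. *)
have mNE : measurable [set w | N (E w) w = k].
  apply/measurable_indicP; apply: (@measurable_fun_cvg _ _ _ _ (fun m => \1_(A m))) => //.
have int1 : P.-integrable setT (EFin \o cst 1) by exact: finite_measure_integrable_cst.
have PA_cvg : P (A m) @[m --> \oo] --> P [set w | N (E w) w = k].
  rewrite -[P [set w | _]](_ : (\int[P]_w (\1_[set w | N (E w) w = k] w)%:E)%E = _);
    last by rewrite integral_indic// setIT.
  rewrite (_ : (fun m => P (A m)) = (fun m => (\int[P]_w (\1_(A m) w)%:E)%E)); last first.
    by apply/funext => m; rewrite integral_indic// setIT.
  have [] := @dominated_convergence _ _ _ P setT measurableT
    (fun m w => (\1_(A m) w)%:E) (fun w => (\1_[set w | N (E w) w = k] w)%:E)
    (EFin \o cst 1) _ _ _ int1 _ => //.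
  - by move=> m; apply/measurable_EFinP; exact: measurable_indic.
  - by apply/measurable_EFinP; exact: measurable_indic.
  - by apply: aeW => w _; apply: cvg_EFin; [exact: nearW|exact: A_cvg].
  - by apply: aeW => w m _ /=; rewrite lee_fin ger0_norm// indicE lern1 leq_b1.
have int_cvg : (\int[P]_w (poisson_weight rate k (up m (grid m w)))%:E)%E @[m --> \oo]
    --> (\int[P]_w (pos_poisson_weight rate k (E w))%:E)%E.
  have [] := @dominated_convergence _ _ _ P setT measurableT
    (fun m w => (poisson_weight rate k (up m (grid m w)))%:E)
    (fun w => (pos_poisson_weight rate k (E w))%:E)
    (EFin \o cst 1) _ _ _ int1 _ => //.
  - move=> m; apply/measurable_EFinP.
    exact: (measurable_grid_comp m (fun j => poisson_weight rate k (up m j))).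
  - apply/measurable_EFinP.
    exact: (measurableT_comp (measurable_pos_poisson_weight rate k) mE).
  - apply: aeW => w _; apply: cvg_EFin; first exact: nearW.
    apply: (cvg_comp _ _ (@up_cvg w)); apply: cvg_at_right_filter.
    exact: continuous_poisson_weight.
  - apply: aeW => w m _ /=; have u0 : 0 <= up m (grid m w) by rewrite divr_ge0.
    by rewrite lee_fin ger0_norm ?poisson_weight_le1 ?poisson_weight_ge0// ltW.
move: PA_cvg; rewrite (_ : (fun m => P (A m)) =
  (fun m => (\int[P]_w (poisson_weight rate k (up m (grid m w)))%:E)%E)); last first.
  by apply/funext => m; exact/esym/integral_grid.
by move=> /cvg_unique; apply.
Unshelve. all: by end_near. Qed.

End random_time.

(** * Mixing over the number of jumps *)

Section compound_poisson_exponential.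
Context {R : realType} {d : measure_display} {T : measurableType d}.
Variables (P : probability T R) (lambda b : R).
Variables (N : R -> {RV P >-> nat}) (xi : nat -> {RV P >-> R}).
Hypotheses (lambda_gt0 : 0 < lambda) (b_gt0 : 0 < b).
Hypothesis EN_compound : compound_poisson_exp lambda b N xi.

Let S n w := \sum_(j < n) xi j w.

Let mNt t n : measurable [set w | N t w = n].
Proof. exact: (measurable_funPTI (N t) (Y := [set n])). Qed.

Lemma measurable_compound t : measurable_fun setT (compound N xi t).
Proof.
move=> _ B mB; rewrite setTI [X in measurable X](_ : _ =
  \bigcup_n ([set w | N t w = n] `&` S n @^-1` B)); last first.
  apply/seteqP; split => [w Bw|w [n _ [/= wn]]]; first by exists (N t w).
  by rewrite /compound wn.
apply: bigcup_measurable => n _; apply: measurableI; first exact: mNt.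
by rewrite -[X in measurable X]setTI; exact: measurable_sum_jumps.
Qed.

Lemma compound_sum_indep t n (C : set R) : measurable C ->
  P ([set w | N t w = n] `&` S n @^-1` C) =
  (P [set w | N t w = n] * P (S n @^-1` C))%E.
Proof.
move=> mC; apply: (compound_indep EN_compound).
  apply: sub_sigma_algebra; exists t => //; exists [set n] => //.
  by rewrite setTI.
rewrite /sigma_of_family; set G := \bigcup_i _.
(* [S n] is measurable for the sigma-algebra generated by the jumps, so its events are among those
   independent of [N]. *)
have mS : measurable_fun (setT : set (g_sigma_algebraType G))
    (S n : g_sigma_algebraType G -> R).
  apply: measurable_sum => j _ B mB; apply: sub_sigma_algebra.
  by exists (nat_of_ord j) => //; exists B.
by have := mS measurableT C mC; rewrite setTI.
Qed.

(** Partition by the value n of [N t]: on each piece the compound process is the sum of n jumps, and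
    the Poisson probability of n factors out. *)
Lemma integral_compound c k t : 0 <= c -> 0 <= t ->
  (\int[P]_w (pos_poisson_weight c k (compound N xi t w))%:E)%E =
  (closed_form lambda (b / (c + b)) (c / (c + b)) k t)%:E.
Proof.
move=> c0 t0; rewrite -closed_form_series.
pose G n := [set w | N t w = n].
have tG : trivIset setT G by exact: (@trivIset_preimage1 _ _ setT (N t)).
have UG : setT = \bigcup_n G n by apply/seteqP; split => // w _; exists (N t w).
rewrite UG ge0_integral_bigcup//; last 3 first.
  by move=> n; exact: mNt.
  rewrite -UG; apply/measurable_EFinP.
  exact: (measurableT_comp (measurable_pos_poisson_weight c k) (@measurable_compound t)).
  by move=> w _; rewrite lee_fin pos_poisson_weight_ge0.
apply: eq_eseriesr => n _.
rewrite (eq_integral (fun w => (pos_poisson_weight c k (S n w))%:E)); last first.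
  by move=> w; rewrite inE /G /= /compound => ->.
rewrite integral_mkcond.
rewrite (eq_integral (fun w =>
  (\1_(G n) w)%:E * (pos_poisson_weight c k (S n w))%:E)%E); last first.
  move=> w _; rewrite patchE indicE; case: (w \in G n); first by rewrite mul1e.
  by rewrite mul0e.
pose Sn : {RV P >-> R} := HB.pack (S n)
  (isMeasurableFun.Build _ _ _ _ (S n) (measurable_sum_jumps xi n)).
(* Weighted by the indicator of [G n], the law of [S n] is multiplied by the probability of [G n]:
   this is the independence of [N] and the jumps. *)
rewrite (@integral_transfer _ _ _ _ _ P (distribution P Sn) (S n) (\1_(G n))
  (poisson_weight lambda n t) _ _ _ _ (fun x => (pos_poisson_weight c k x)%:E)).
- rewrite ge0_integral_distribution//; last 2 first.
  + by apply/measurable_EFinP; exact: measurable_pos_poisson_weight.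
  + by move=> x; rewrite lee_fin pos_poisson_weight_ge0.
  rewrite (integral_sum_jumps c0 b_gt0 (compound_jump_law EN_compound)
    (compound_jump_indep EN_compound)).
  by rewrite -EFinM.
- exact: measurable_sum_jumps.
- by apply: measurable_indic; exact: mNt.
- by move=> w; rewrite indicE.
- move=> C mC; have mG : measurable (G n) by exact: mNt.
  have mSC : measurable (S n @^-1` C).
    by rewrite -[X in measurable X]setTI; exact: measurable_sum_jumps.
  rewrite integral_indic//.
  rewrite -(poisson_process_marginal lambda_gt0 (compound_poisson_process EN_compound))//.
  exact: compound_sum_indep.
- by apply/measurable_EFinP; exact: measurable_pos_poisson_weight.
- by move=> x; rewrite lee_fin pos_poisson_weight_ge0.
Qed.

End compound_poisson_exponential.

(** At negative times the compound process is an empty sum and the state probabilities are constant;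
    hence the equation at time 0 is stated with the right derivative. *)
Theorem theorem2 (R : realType) (d : measure_display) (T : measurableType d)
    (P : probability T R) (lambda lambda1 beta : R)
    (N1 N : R -> {RV P >-> nat}) (xi : nat -> {RV P >-> R})
    (lambda_gt0 : 0 < lambda) (lambda1_gt0 : 0 < lambda1) (beta_gt0 : 0 < beta)
    (N1_poisson : poisson_process lambda1 N1)
    (EN_compound : compound_poisson_exp lambda beta N xi)
    (EN_N1_indep : independent_families P (compound N xi) N1) :
  let p := state_prob P (iterated N1 (compound N xi)) in
  let rhs (k : nat) (t : R) :=
    - lambda * (lambda1 / (lambda1 + beta)) * p k t +
    lambda * beta / (lambda1 + beta) *
      \sum_(1 <= m < k.+1) (lambda1 / (lambda1 + beta)) ^+ m * p (k - m)%N t in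
  [/\ forall (k : nat) (t : R), (1 <= k)%N -> 0 <= t ->
        p k t = expR (- lambda * t) *
          (lambda1 ^+ k * lambda * beta * t / (lambda1 + beta) ^+ k.+1) *
          mittag_leffler3 1 2 k.+1%:R (lambda * beta * t / (lambda1 + beta)),
      forall t : R, 0 <= t ->
        p 0%N t = expR (- (lambda * lambda1 * t / (lambda1 + beta))),
      forall (k : nat) (t : R), 0 < t -> is_derive t 1 (p k) (rhs k t)
    & forall k : nat, h^-1 * (p k h - p k 0) @[h --> 0^'+] --> rhs k 0].
Proof.
move=> p rhs.
have lb0 : 0 < lambda1 + beta by rewrite addr_gt0.
have ab1 : beta / (lambda1 + beta) + lambda1 / (lambda1 + beta) = 1.
  by rewrite -mulrDl addrC divff// gt_eqF.
set a := beta / (lambda1 + beta) in ab1.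
set q := lambda1 / (lambda1 + beta) in ab1.
pose f := closed_form lambda a q.
have EN_ind t (C : set R) s k : measurable C ->
    P (compound N xi t @^-1` C `&` [set w | N1 s w = k]) =
    (P (compound N xi t @^-1` C) * P [set w | N1 s w = k])%E.
  move=> mC; apply: EN_N1_indep; apply: sub_sigma_algebra.
    by exists t => //; exists C => //; rewrite setTI.
  by exists s => //; exists [set k] => //; rewrite setTI.
have pE k (t : R) : 0 <= t -> p k t = f k t.
  move=> t0; rewrite /p /state_prob /iterated.
  rewrite (poisson_process_random_time lambda1_gt0 N1_poisson
    (@measurable_compound _ _ _ P N xi t) (EN_ind t)).
  by rewrite (integral_compound lambda_gt0 beta_gt0 EN_compound _ (ltW lambda1_gt0) t0).
have rhsE k (t : R) : 0 <= t -> rhs k t = - lambda * q * f k t +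
    lambda * a * \sum_(1 <= m < k.+1) q ^+ m * f (k - m)%N t.
  move=> t0; rewrite /rhs pE// -[lambda * beta / _]mulrA; congr (_ + _ * _).
  by apply: eq_bigr => m _; rewrite pE.
have df k (t : R) : is_derive t 1 (f k) (- lambda * q * f k t +
    lambda * a * \sum_(1 <= m < k.+1) q ^+ m * f (k - m)%N t).
  exact: is_derive_closed_form.
split.
- move=> k t k1 t0; rewrite pE// /f closed_form_mittag_leffler//.
  rewrite (_ : lambda * beta * t / (lambda1 + beta) = lambda * a * t); last first.
    by rewrite /a; ring.
  congr (_ * _); rewrite mulNr -mulrA; congr (_ * _).
  rewrite /q /a exprMn exprVn exprS; field.
  by rewrite expf_neq0 gt_eqF.
- move=> t t0; rewrite pE// /f closed_form0; congr expR.
  by rewrite (_ : 1 - a = q) /q; [ring|rewrite -ab1 addrC addKr].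
- move=> k t t0; rewrite rhsE ?ltW//.
  (* For t > 0 the state probability and the closed form agree on a whole neighbourhood of [t]. *)
  apply: near_eq_is_derive (df k t).
  by near=> s; rewrite pE// ltW//; near: s; exact: lt_nbhsr.
- move=> k; rewrite rhsE//.
  (* The closed form has a two-sided derivative at 0; its difference quotient is restricted to h >
     0, where it is that of [p k]. *)
  have [/cvg_ex[l /= fl] fE] := df k 0.
  rewrite -fE (_ : 'D_1 (f k) 0 = l); last exact: cvg_lim fl.
  have {}fl : h^-1 * (f k h - f k 0) @[h --> 0^'+] --> l.
    apply: cvg_dnbhs_at_right; move: fl; apply: cvg_trans.
    by apply: near_eq_cvg; near=> h; rewrite /= /GRing.scale/= mulr1 addr0.
  apply: cvg_trans fl; apply: near_eq_cvg; near=> h.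
  have h0 : 0 < h by near: h; exact: nbhs_right_gt.
  by rewrite !pE// ltW.
Unshelve. all: by end_near. Qed.
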